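(* Let $\mathbb{F}_q$ be a finite field with elements $\alpha_1,\ldots,\alpha_q$, let $\mathcal{A}=\{\alpha_1,\ldots,\alpha_q\}=\mathbb{F}_q$, let $s\ge1$, let $V=(v_{i,j})\in(\mathbb{F}_q^\ast)^{s\times q}$, let $0\le k\le sq$, and let $C=\operatorname{HRS}_k(\mathcal{A},V,s,q)$. Then the Euclidean dual code is $C^\perp=\{W(g)=(w_{i,j}(g))_{1\le i\le s,\,1\le j\le q}: g\in\mathcal{P}_{<sq-k}\}$, where \[ w_{i,j}(g)=\frac{(-1)^s}{v_{i,j}}\sum_{\tau=0}^{\lfloor (s-i)/(q-1)\rfloor}\binom{s+\tau-1}{\tau}\,\partial^{(s-i-\tau(q-1))}g(\alpha_j). \] In particular, if $s<q$ and $V^\perp=(v^\perp_{i,j})_{1\le i\le s,\,1\le j\le q}$ is defined by $v^\perp_{i,j}=\dfrac{(-1)^s}{v_{s-i+1,j}}$, then \[ C^\perp=\operatorname{Rev}\left(\operatorname{HRS}_{sq-k}(\mathcal{A},V^\perp,s,q)\right). \]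
   Context: For an integer $h\ge 0$, $\mathcal{P}_{<h}=\{f\in\mathbb{F}_q[x]:\deg f<h\}$, with $\mathcal{P}_{<0}=\{0\}$. Hasse derivative (hyperderivative): for $f(x)=\sum_\ell f_\ell x^\ell\in\mathbb{F}_q[x]$ and $j\ge0$, $\partial^{(j)}f(x)=\sum_{\ell}\binom{\ell}{j}f_\ell x^{\ell-j}$ (with $\binom{\ell}{j}=0$ if $j>\ell$). Binomial coefficients are viewed as elements of $\mathbb{F}_q$. Hyperderivative Reed–Solomon (HRS) code: for pairwise distinct $\alpha_1,\ldots,\alpha_r\in\mathbb{F}_q$, $\mathcal{A}=\{\alpha_1,\ldots,\alpha_r\}$, $V=(v_{i,j})\in(\mathbb{F}_q^\ast)^{s\times r}$ and $0\le k\le rs$, \[ \operatorname{HRS}_k(\mathcal{A},V,s,r)=\left\{\bigl(v_{i,j}\,\partial^{(i-1)}f(\alpha_j)\bigr)_{1\le i\le s,\,1\le j\le r}: f\in\mathcal{P}_{<k}\right\}\subseteq\operatorname{Mat}_{s\times r}(\mathbb{F}_q). \] Euclidean inner product on $\operatorname{Mat}_{s\times r}(\mathbb{F}_q)$: $\langle A,B\rangle=\sum_{i,j}a_{i,j}b_{i,j}$; the Euclidean dual of a linear code $C$ is $C^\perp=\{B:\langle A,B\rangle=0\text{ for all }A\in C\}$. Row reversal: $\operatorname{Rev}:\operatorname{Mat}_{s\times r}(\mathbb{F}_q)\to\operatorname{Mat}_{s\times r}(\mathbb{F}_q)$, $\operatorname{Rev}((a_{i,j}))=(a_{s-i+1,j})$,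 applied to a code elementwise. *)

(* Defs.v *)
From mathcomp Require Import all_boot all_order all_algebra.
From mathcomp Require Import qpoly.

Set Implicit Arguments.
Unset Strict Implicit.
Unset Printing Implicit Defensive.

Import GRing.Theory.
Local Open Scope ring_scope.

(* Rows and columns are numbered from 0, so the entry in row i (that is, row
   i + 1 in 1-based numbering) carries the hyperderivative of order i.
   The type {poly_h F} consists of the polynomials p with size p <= h, i.e. of
   degree < h, and {poly_0 F} contains only 0.  The Hasse derivative
   (hyperderivative) of order j is p^`N(j). *)

Definition hrs_word (F : finFieldType) (s r : nat) (alpha : 'I_r -> F)
    (V : 'M[F]_(s, r)) (f : {poly F}) : 'M[F]_(s, r) :=
  \matrix_(i < s, j < r) (V i j * (f^`N(i)).[alpha j]).

(* This is the usual code when alpha is injective, V has no zero entry and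
   k <= s * r; these conditions are left to the statements about it. *)
Definition HRS (F : finFieldType) (s r : nat) (alpha : 'I_r -> F)
    (V : 'M[F]_(s, r)) (k : nat) : {set 'M[F]_(s, r)} :=
  [set hrs_word alpha V f | f : {poly_k F}].

Definition mx_inner (F : finFieldType) (s r : nat) (A B : 'M[F]_(s, r)) : F :=
  \sum_(i < s) \sum_(j < r) A i j * B i j.

Definition euclidean_dual (F : finFieldType) (s r : nat)
    (C : {set 'M[F]_(s, r)}) : {set 'M[F]_(s, r)} :=
  [set B : 'M[F]_(s, r) | [forall A in C, mx_inner A B == 0]].

Definition row_rev (F : finFieldType) (s r : nat) (A : 'M[F]_(s, r)) :
    'M[F]_(s, r) :=
  \matrix_(i < s, j < r) A (rev_ord i) j.

(* Main.v *)
Require Import Defs.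
From mathcomp Require Import all_boot all_order all_algebra.
From mathcomp Require Import qpoly finfield ring zify.

Set Implicit Arguments.
Unset Strict Implicit.
Unset Printing Implicit Defensive.

Import GRing.Theory.
Local Open Scope ring_scope.

(** Write P for (1 - X^(q-1))^-s and L(h) for the sum over all a in F of the
coefficient of X^(s-1) in h(X + a) P.  Up to sign, L(h) is the sum of the
residues of h / (X^q - X)^s at the points of F, hence it only sees the residue
at infinity: L(h) = (-1)^s h_(sq-1) when deg h < sq.  This is proved by
induction on s, by division of h by X^q - X, since (X + a)^q - (X + a) =
- X (1 - X^(q-1)).  As the Hasse derivatives at a are the coefficients of
f(X + a), the inner product of the word of f with W(g) is (-1)^s L(f g), the
coefficient of X^(sq-1) in f g.  Taking f to be a monomial shows that W is
injective on polynomials of degree < sq, hence bijective by counting, and that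
W(g) is orthogonal to the code if and only if deg g < sq - k. *)

Lemma coef_comp_XaddC (R : comNzRingType) (p : {poly R}) (a : R) (i : nat) :
  (p \Po ('X + a%:P))`_i = p^`N(i).[a].
Proof.
elim/poly_ind: p i => [|p c IHp] i.
  by rewrite comp_poly0 coef0 linear0 horner0.
rewrite comp_poly_MXaddC mulrDr !coefD coefMX coefMC coefC !IHp.
case: i => [|i] /=; first by rewrite !nderivn0 !hornerE.
by rewrite nderivnMXaddC !hornerE.
Qed.

Lemma size_mul_le (R : nzRingType) (f g : {poly R}) m n :
  (size f <= m)%N -> (size g <= n)%N ->
  (size (f * g)%R <= (m + n).-1)%N.
Proof.
move=> szf szg; apply: leq_trans (size_polyMleq _ _) _.
by rewrite -!subn1 leq_sub2r // leq_add.
Qed.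

Section FiniteField.

Variable F : finFieldType.
Implicit Types (a b : F) (f g h p : {poly F}).
Local Notation q := #|F|.

Let q_gt1 : (1 < q)%N.
Proof. exact: finNzRing_gt1. Qed.

Let qK : q.-1.+1 = q.
Proof. exact: prednK (ltnW q_gt1). Qed.

Let q1_gt0 : (0 < q.-1)%N.
Proof. by rewrite -ltnS qK. Qed.

(** * Power sums over [F] *)

Lemma natr_card : q%:R = 0 :> F.
Proof.
have: \sum_(a : F) (a + 1) = \sum_(a : F) a.
  by rewrite [RHS](reindex_inj (addIr 1)).
rewrite big_split /= sumr_const => /(canRL (addKr _)).
by rewrite addNr.
Qed.

(** For positive [m], scaling by a nonzero [b] permutes [F] and multiplies the sum by [b ^+ m]. Some
    such [b] has [b ^+ m != 1], as ['X^m - 1] has at most [m] roots. *)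
Lemma sum_expr_card m : (m < q.-1)%N -> \sum_(a : F) a ^+ m = 0.
Proof.
case: m => [_ | m ltmq].
  by rewrite (eq_bigr (fun=> 1)) ?sumr_const ?natr_card.
have [b nzb nzb1] : exists2 b : F, b != 0 & b ^+ m.+1 != 1.
  apply/exists_inP; apply: contraLR ltmq => /exists_inPn roots_unity.
  have nzp : 'X^(m.+1) - 1 != 0 :> {poly F}
    by rewrite monic_neq0 // monicXnsubC.
  rewrite -leqNgt -ltnS -(size_XnsubC (1 : F) (ltn0Sn m)).
  rewrite -(cardC1 (0 : F)) cardE.
  apply: (max_poly_roots nzp); last exact: enum_uniq.
  apply/allP=> b; rewrite mem_enum => /roots_unity; rewrite negbK => /eqP bm1.
  by rewrite rootE !hornerE bm1 subrr.
apply: (mulfI (_ : b ^+ m.+1 - 1 != 0)); first by rewrite subr_eq0.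
rewrite mulr0 mulrBl mul1r mulr_sumr; apply/eqP; rewrite subr_eq0; apply/eqP.
rewrite [RHS](reindex_inj (mulfI nzb)).
by apply: eq_bigr => a _; rewrite exprMn.
Qed.

Lemma sum_expr_card_pred : \sum_(a : F) a ^+ q.-1 = -1.
Proof.
have expU a : a != 0 -> a ^+ q.-1 = 1.
  move=> nza; apply: (mulfI nza).
  by rewrite -exprS qK expf_card mulr1.
rewrite (bigD1 0) //= expr0n gtn_eqF // add0r.
rewrite (eq_bigr (fun=> 1)) // sumr_const cardC1.
by apply: (addIr 1); rewrite addNr natr1 qK natr_card.
Qed.

Lemma sum_horner_card p : (size p <= q)%N -> \sum_a p.[a] = - p`_q.-1.
Proof.
rewrite -{1}qK => szp; under eq_bigr do rewrite (horner_coef_wide _ szp).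
rewrite exchange_big /= big_ord_recr /= -mulr_sumr.
rewrite sum_expr_card_pred mulrN1 big1 ?add0r // => i _.
by rewrite -mulr_sumr sum_expr_card ?mulr0.
Qed.

(** * Sums of residues at the points of [F] *)

(* Truncation of the power series (1 - X^(q-1))^-(n+1). *)
Definition geom_pow (N n : nat) : {poly F} :=
  \sum_(t < N) 'C(n + t, n)%:R *: 'X^(t * q.-1).

Lemma coef_mul_geom_pow N n p m :
  (p * geom_pow N n)`_m =
  \sum_(t < N | (t * q.-1 <= m)%N) 'C(n + t, n)%:R * p`_(m - t * q.-1).
Proof.
rewrite /geom_pow mulr_sumr coef_sum [RHS]big_mkcond; apply: eq_bigr => t _.
by rewrite -scalerAr coefZ coefMXn ltnNge; case: leqP; rewrite /= ?mulr0.
Qed.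

(** Pascal's rule, by induction on [N]; the subtracted monomial is the truncation error. *)
Lemma geom_powS N n :
  (1 - 'X^(q.-1)) * geom_pow N n.+1 =
  geom_pow N n - 'C(n + N, n.+1)%:R *: 'X^(N * q.-1).
Proof.
rewrite /geom_pow; elim: N => [|N IHN].
  by rewrite !big_ord0 addn0 bin_small // scale0r mulr0 subr0.
rewrite !big_ord_recr /= mulrDr IHN mulSn exprD addSn addnS binS natrD.
rewrite !scalerDl -!mul_polyC; ring.
Qed.

(* Up to the sign [(-1) ^+ n.+1], this is the sum of the residues of
   [h / (X^q - X) ^ n.+1] at the points of [F]. *)
Definition res_sum (N n : nat) h : F :=
  \sum_a ((h \Po ('X + a%:P)) * geom_pow N n)`_n.

Lemma res_sumD N n h1 h2 :
  res_sum N n (h1 + h2) = res_sum N n h1 + res_sum N n h2.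
Proof.
by rewrite -big_split; apply: eq_bigr => a _; rewrite comp_polyD mulrDl coefD.
Qed.

Lemma res_sum_mul N n h : (n < N)%N ->
  res_sum N n.+1 (h * ('X^q - 'X)) = - res_sum N n h.
Proof.
move=> ltnN; rewrite -sumrN; apply: eq_bigr => a _.
have shiftE :
    ('X^q - 'X) \Po ('X + a%:P) = - ('X * (1 - 'X^(q.-1))) :> {poly F}.
  (* ['X^q - 'X] is the product of all the ['X - x%:P], and translation by [a] permutes these
     factors. *)
  rewrite mulrBr mulr1 -exprS qK opprB finField_genPoly.
  rewrite rmorph_prod [RHS](reindex_inj (subIr a)); apply: eq_bigr => x _ /=.
  by rewrite comp_polyB comp_polyX comp_polyC polyCB opprB addrA.
rewrite comp_polyM shiftE mulrN mulNr coefN; congr (- _).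
rewrite -!mulrA geom_powS mulrCA coefXM /= mulrBr coefB.
(* The truncation error has degree [N * q.-1 > n], beyond the coefficient that is read. *)
rewrite -scalerAr coefZ coefMXn ifT ?mulr0 ?subr0 //.
by rewrite (leq_trans ltnN) // leq_pmulr.
Qed.

(** Absorption makes the binomial an integer multiple of [q]. *)
Lemma bin_mul_card t : (0 < t)%N -> 'C(t * q, t)%:R = 0 :> F.
Proof.
move=> t_gt0; have -> : 'C(t * q, t) = (q * 'C((t * q).-1, t.-1))%N.
  by apply/eqP; rewrite -(eqn_pmul2l t_gt0) mulnA mul_bin_diag prednK.
by rewrite natrM natr_card mul0r.
Qed.

(** Summing over [a] leaves, for each [t], a multiple of the coefficient of index [q.-1] in the
    Hasse derivative of [h] of order [n.+1 - t * q.-1]. A positive order kills it by degree. *)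
Lemma res_sum_small N n h : (size h <= q)%N -> res_sum N n.+1 h = 0.
Proof.
move=> szh; rewrite /res_sum; under eq_bigr do rewrite coef_mul_geom_pow.
rewrite exchange_big /= big1 // => t letn.
rewrite -mulr_sumr; under eq_bigr do rewrite coef_comp_XaddC.
rewrite sum_horner_card; last first.
  by apply/leq_sizeP=> j leqj; rewrite coef_nderivn nth_default ?mul0rn //
     (leq_trans szh) // (leq_trans leqj) // leq_addl.
rewrite coef_nderivn; have [|gtne] := posnP (n.+1 - t * q.-1)%N.
  (* At order zero the weight is ['C(t * q, t)], which is zero in [F]. *)
  move/eqP; rewrite subn_eq0 => gent.
  have def_n : n.+1 = (t * q.-1)%N by apply/eqP; rewrite eqn_leq gent.
  have t_gt0 : (0 < t)%N by case: (t : nat) def_n.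
  rewrite {1 2}def_n -mulnSr qK -bin_sub.
    by rewrite -{2}qK mulnS addnK bin_mul_card ?mul0r.
  by rewrite leq_mul2l leq_pred orbT.
rewrite nth_default ?mul0rn ?oppr0 ?mulr0 // (leq_trans szh) //.
by rewrite -[leqLHS]qK -add1n leq_add2r.
Qed.

Lemma res_sum_coef N n h : (n < N)%N -> (size h <= n.+1 * q)%N ->
  res_sum N n h = (-1) ^+ n.+1 * h`_(n.+1 * q).-1.
Proof.
elim: n h => [|n IHn] h ltnN szh.
  rewrite mul1n in szh *; rewrite expr1 mulN1r -sum_horner_card //.
  apply: eq_bigr => a _; rewrite coef_mul_geom_pow (bigD1 (Ordinal ltnN)) //=.
  rewrite bin0 mul1r coef_comp_XaddC nderivn0 big1 ?addr0 // => t /andP[].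
  by rewrite leqn0 muln_eq0 -val_eqE [q.-1 == _]gtn_eqF // orbF => ->.
have szd : size ('X^q - 'X : {poly F}) = q.+1.
  by rewrite size_polyDl size_polyXn // size_polyN size_polyX ltnS.
have szr : (size (h %% ('X^q - 'X))%R <= q)%N.
  by rewrite -ltnS -szd ltn_modp -size_poly_gt0 szd.
have szu : (size (h %/ ('X^q - 'X))%R <= n.+1 * q)%N.
  by rewrite size_divp -?size_poly_gt0 szd // leq_subLR -mulSn.
rewrite {1}(divp_eq h ('X^q - 'X)) res_sumD (res_sum_small _ _ szr) addr0.
rewrite (res_sum_mul _ (ltnW ltnN)) (IHn _ (ltnW ltnN) szu) [in RHS]exprS.
rewrite mulN1r mulNr; congr (- (_ * _)).
(* Only the product of the quotient by ['X^q] reaches the top index: the product by ['X] falls short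
   because [q] is at least 2. *)
rewrite {2}(divp_eq h ('X^q - 'X)) coefD mulrBr !coefB coefMX coefMXn.
have q_gt0 := ltnW q_gt1.
have idxE : ((n.+2 * q).-1 = (n.+1 * q).-1 + q)%N by rewrite mulSn addnC; lia.
rewrite idxE ltnNge leq_addl addnK /= gtn_eqF ?addn_gt0 ?q_gt0 ?orbT //.
rewrite (nth_default 0 (leq_trans szr (leq_addl _ _))) addr0.
rewrite [_`_(_ + q).-1]nth_default ?subr0 // (leq_trans szu) //.
by move: (n.+1 * q)%N => m; lia.
Qed.

End FiniteField.

Section Dual.

Variables (F : finFieldType) (q : nat).
Hypothesis q_card : #|F| = q.
Variable (alpha : 'I_q -> F).
Hypothesis alpha_inj : injective alpha.
Variables (s : nat) (V : 'M[F]_(s.+1, q)).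
Hypothesis V_neq0 : forall i j, V i j != 0.

(** The index [s - i] complements the order [i] of the Hasse derivative, so that each column of the
    inner product is a Cauchy product read at ['X^s]. *)
Definition dual_word (g : {poly F}) : 'M[F]_(s.+1, q) :=
  \matrix_(i, j) ((-1) ^+ s.+1 / V i j *
     ((g \Po ('X + (alpha j)%:P)) * geom_pow F s.+1 s)`_(s - i)).

Lemma mx_inner_dual_word (f g : {poly F}) : (size (f * g)%R <= s.+1 * q)%N ->
  mx_inner (hrs_word alpha V f) (dual_word g) = (f * g)`_(s.+1 * q).-1.
Proof.
move=> szfg; transitivity ((-1) ^+ s.+1 * res_sum s.+1 s (f * g)); last first.
  rewrite res_sum_coef ?q_card // mulrA -exprD addnn -mul2n exprM sqrrN expr1n.
  by rewrite expr1n mul1r.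
have alpha_bij : bijective alpha.
  by apply: inj_card_bij; rewrite ?q_card ?card_ord.
rewrite /res_sum (reindex alpha) /=; last exact: onW_bij.
rewrite /mx_inner exchange_big mulr_sumr; apply: eq_bigr => j _ /=.
rewrite comp_polyM -mulrA coefM mulr_sumr; apply: eq_bigr => i _.
rewrite !mxE coef_comp_XaddC mulrACA.
by rewrite [V i j * _]mulrC -!mulrA mulKf // mulrCA.
Qed.

Lemma size_orthogonal_dual_word k (g : {poly F}) :
    (k <= s.+1 * q)%N -> (size g <= s.+1 * q)%N ->
    (forall f : {poly F}, (size f <= k)%N ->
       mx_inner (hrs_word alpha V f) (dual_word g) = 0) ->
  (size g <= s.+1 * q - k)%N.
Proof.
move=> lek szg orth_g; rewrite leqNgt; apply/negP => gtg.
have nzg : g != 0 by rewrite -size_poly_gt0 (leq_trans _ gtg).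
(* This monomial moves the leading coefficient of [g] to the index that the inner product reads. *)
pose f : {poly F} := 'X^(s.+1 * q - size g).
have szf : (size f <= k)%N by rewrite size_polyXn; lia.
have szfg : size (f * g)%R = (s.+1 * q)%N.
  by rewrite size_monicM ?monicXn // size_polyXn addSn subnK.
have /eqP := orth_g f szf.
rewrite mx_inner_dual_word ?szfg // -szfg -lead_coefE lead_coef_eq0.
by rewrite -size_poly_eq0 szfg; lia.
Qed.

Lemma dual_word_inj (g : {poly F}) :
  (size g <= s.+1 * q)%N -> dual_word g = 0 -> g = 0.
Proof.
(* The case [k = s.+1 * q] of the size bound. *)
move=> szg W0; apply/eqP; rewrite -size_poly_leq0 -(subnn (s.+1 * q)).
apply: size_orthogonal_dual_word => // f _; rewrite W0 /mx_inner big1 // => i _.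
by rewrite big1 // => j _; rewrite !mxE mulr0.
Qed.

Lemma dual_wordB (g1 g2 : {poly F}) :
  dual_word (g1 - g2) = dual_word g1 - dual_word g2.
Proof.
by apply/matrixP=> i j; rewrite !mxE comp_polyB mulrBl coefB mulrBr.
Qed.

Lemma dual_word_surj B :
  exists2 g : {poly F}, (size g <= s.+1 * q)%N & dual_word g = B.
Proof.
have W_inj : injective (fun g : {poly_(s.+1 * q) F} => dual_word g).
  move=> g1 g2 eqW; apply/val_inj/eqP; rewrite -subr_eq0; apply/eqP.
  apply: dual_word_inj; last by rewrite dual_wordB eqW subrr.
  by rewrite (leq_trans (size_polyD _ _)) // size_polyN geq_max !size_npoly.
have [|W' _ WK] := inj_card_bij W_inj; first by rewrite card_mx card_npoly.
by exists (W' B); rewrite ?size_npoly.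
Qed.

Lemma euclidean_dual_HRS k : (k <= s.+1 * q)%N ->
  euclidean_dual (HRS alpha V k) =
  [set dual_word g | g : {poly_(s.+1 * q - k) F}].
Proof.
move=> lek; apply/setP=> B; rewrite inE.
apply/forall_inP/imsetP => [orthB | [g _ ->] _ /imsetP[f _ ->]].
  have [g szg defB] := dual_word_surj B; subst B.
  suff szgk : (size g <= s.+1 * q - k)%N by exists (NPoly szgk).
  apply: size_orthogonal_dual_word => // f szf; apply/eqP/orthB.
  by apply/imsetP; exists (NPoly szf).
(* The product has size at most [(s.+1 * q).-1], one too small for the coefficient that is read. *)
have := size_mul_le (size_npoly f) (size_npoly g); rewrite subnKC // => szfg.
by rewrite mx_inner_dual_word ?nth_default // (leq_trans szfg) ?leq_pred.
Qed.

End Dual.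

Theorem corollary9 (F : finFieldType) (q : nat) (hq : #|F| = q)
    (alpha : 'I_q -> F) (halpha : injective alpha)
    (s : nat) (hs : (1 <= s)%N)
    (V : 'M[F]_(s, q)) (hV : forall i j, V i j != 0)
    (k : nat) (hk : (k <= s * q)%N) :
  let C := HRS alpha V k in
  euclidean_dual C =
    [set \matrix_(i < s, j < q)
           ((-1) ^+ s / V i j *
            \sum_(0 <= tau < ((s - i.+1) %/ (q - 1)).+1)
               ('C(s + tau - 1, tau))%:R *
               ((g : {poly F})^`N(s - i.+1 - tau * (q - 1))).[alpha j])
    | g : {poly_(s * q - k) F}]
  /\ ((s < q)%N ->
      let Vperp : 'M[F]_(s, q) :=
        \matrix_(i < s, j < q) ((-1) ^+ s / V (rev_ord i) j) in
      euclidean_dual C =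
        [set row_rev A | A in HRS alpha Vperp (s * q - k)]).
Proof.
case: s hs V hV hk => // s _ V hV hk C.
have q_gt1 : (1 < q)%N by rewrite -hq finNzRing_gt1.
have dual_C : euclidean_dual C = _ := euclidean_dual_HRS hq halpha hV hk.
split=> [|lt_sq Vperp]; rewrite {}dual_C.
  apply: eq_imset => g; apply/matrixP=> i j; rewrite !mxE; congr (_ * _).
  rewrite coef_mul_geom_pow hq subSS -subn1 big_mkord.
  (* The truncation at [s.+1] terms keeps the whole range of [tau]. *)
  have le_is : ((s - i) %/ (q - 1) < s.+1)%N.
    by rewrite ltnS (leq_trans (leq_div _ _)) ?leq_subr.
  rewrite (big_ord_widen _ (fun tau => 'C(s.+1 + tau - 1, tau)%:R *
     (nderivn (s - i - tau * (q - 1)) g).[alpha j]) le_is).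
  apply: eq_big => [t | t _]; first by rewrite ltnS leq_divRL // subn_gt0.
  by rewrite coef_comp_XaddC addSn subSS subn0 -(bin_sub (leq_addl s t)) addnK.
rewrite /HRS -imset_comp; apply: eq_imset => g; apply/matrixP=> i j.
rewrite !mxE rev_ordK coef_mul_geom_pow hq /= subSS -subn1; congr (_ * _).
(* Here [s < q - 1], so only the term [t = 0] remains. *)
rewrite (bigD1 ord0) //= addn0 binn mul1r mul0n subn0.
rewrite coef_comp_XaddC big1 ?addr0 //.
move=> t /andP[le_ts]; rewrite -val_eqE /= -lt0n => t_gt0.
have : (t * (q - 1) <= s)%N := leq_trans le_ts (leq_subr _ _).
rewrite leqNgt => /negP[]; rewrite (leq_trans _ (leq_pmull _ t_gt0)) //.
by rewrite ltn_subRL add1n.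
Qed.
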